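(* Let $R$ be a right Goldie ring. Then the following are equivalent: $R$ is semiprime and pseudo-morphic (or, equivalently, semiprime and quasi-morphic); $R$ is von Neumann regular; $R$ is semisimple artinian.
   Context: Rings are associative with identity. For $a\in R$, $l(a)$ and $r(a)$ are its left and right annihilators in $R$. $R$ is pseudo-morphic if for every $a\in R$ there exist $b,b'\in R$ with $Ra=l(b)$ and $aR=r(b')$. $R$ is quasi-morphic if for every $a\in R$ there exist $b,c,b',c'\in R$ with $Ra=l(b)$, $l(a)=Rc$, $aR=r(b')$, $r(a)=c'R$. $R$ is right Goldie if $R_R$ has finite Goldie (uniform) dimension and $R$ has ACC on right annihilators. *)

(* Defs.v *)
From mathcomp Require Import all_boot all_algebra.
From mathcomp Require Import boolp classical_sets.

Set Implicit Arguments.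
Unset Strict Implicit.
Unset Printing Implicit Defensive.

Local Open Scope classical_set_scope.
Local Open Scope ring_scope.

Definition acc_on (T : Type) (P : set T -> Prop) : Prop :=
  forall F : nat -> set T,
    (forall n, P (F n)) -> (forall n, F n `<=` F n.+1) ->
    exists N, forall n, (N <= n)%N -> F n = F N.

Definition dcc_on (T : Type) (P : set T -> Prop) : Prop :=
  forall F : nat -> set T,
    (forall n, P (F n)) -> (forall n, F n.+1 `<=` F n) ->
    exists N, forall n, (N <= n)%N -> F n = F N.

(* [pzRingType] rather than [nzRingType]: the zero ring is allowed. *)
Section Elements.
Variable R : pzRingType.

Definition lprincipal (a : R) : set R := [set r * a | r in setT].
Definition rprincipal (a : R) : set R := [set a * r | r in setT].

Definition lann (X : set R) : set R := [set x | forall y, X y -> x * y = 0].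
Definition rann (X : set R) : set R := [set x | forall y, X y -> y * x = 0].

Definition left_ideal (I : set R) : Prop :=
  [/\ I 0, forall x y, I x -> I y -> I (x - y) & forall r x, I x -> I (r * x)].

Definition right_ideal (I : set R) : Prop :=
  [/\ I 0, forall x y, I x -> I y -> I (x - y) & forall x r, I x -> I (x * r)].

Definition two_sided_ideal (I : set R) : Prop := left_ideal I /\ right_ideal I.

Definition ideal_mul (I J : set R) : set R :=
  [set x | exists n (a b : 'I_n -> R),
     [/\ forall i, I (a i), forall i, J (b i) & x = \sum_(i < n) a i * b i]].

(* I^0 = R and I^(n+1) = I I^n. *)
Definition ideal_exp (I : set R) (n : nat) : set R :=
  iter n (ideal_mul I) setT.

Definition nilpotent_ideal (I : set R) : Prop :=
  exists n, ideal_exp I n = [set 0].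

(* The sum of the family M is direct. *)
Definition independent (K : eqType) (M : K -> set R) : Prop :=
  forall (s : seq K) (x : K -> R), uniq s -> (forall k, M k (x k)) ->
    \sum_(k <- s) x k = 0 -> forall k, k \in s -> x k = 0.

Definition family_sum (K : eqType) (M : K -> set R) : set R :=
  [set z | exists (s : seq K) (x : K -> R),
     [/\ uniq s, forall k, M k (x k) & z = \sum_(k <- s) x k]].

(* Equivalently, a minimal right ideal. *)
Definition simple_right_ideal (I : set R) : Prop :=
  [/\ right_ideal I, I <> [set 0] &
      forall J, right_ideal J -> J `<=` I -> J = [set 0] \/ J = I].

End Elements.

Section RingProperties.
Variable R : pzRingType.

Definition pseudo_morphic : Prop :=
  forall a : R, exists b b' : R,
    lprincipal a = lann [set b] /\ rprincipal a = rann [set b'].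

Definition quasi_morphic : Prop :=
  forall a : R, exists b c b' c' : R,
    [/\ lprincipal a = lann [set b], lann [set a] = lprincipal c,
        rprincipal a = rann [set b'] & rann [set a] = rprincipal c'].

Definition semiprime : Prop :=
  forall I : set R, two_sided_ideal I -> nilpotent_ideal I -> I = [set 0].

Definition von_neumann_regular : Prop :=
  forall a : R, exists b : R, a = a * b * a.

(* The module R_R contains no infinite direct sum of nonzero submodules. *)
Definition right_finite_dim : Prop :=
  ~ exists M : nat -> set R,
      [/\ forall n, right_ideal (M n), forall n, M n <> [set 0] &
          independent M].

(* Right annihilators are the r(X) for arbitrary subsets X, not only for single
   elements. *)
Definition acc_right_annihilators : Prop :=
  acc_on [set I : set R | exists X : set R, I = rann X].

Definition right_goldie : Prop := right_finite_dim /\ acc_right_annihilators.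

(* R_R is a direct sum of simple modules. *)
Definition semisimple : Prop :=
  exists (K : eqType) (M : K -> set R),
    [/\ forall k, simple_right_ideal (M k), independent M &
        family_sum M = setT].

Definition artinian : Prop :=
  dcc_on (@left_ideal R) /\ dcc_on (@right_ideal R).

Definition semisimple_artinian : Prop := semisimple /\ artinian.

End RingProperties.

(* Main.v *)
(* Under the chain condition, Ra = l(b) gives DCC on principal left ideals, so
   in the semiprime case every nonzero Ra contains a nonzero idempotent ra; the
   passage from a to a - a r a strictly decreases Ra and preserves
   non-regularity, whence R is regular.  Conversely, in a regular ring the
   condition gives DCC on idempotents (r(e) grows as e decreases), a left-right
   symmetric condition which makes one-sided ideals principal and forces DCC on
   them.  A semisimple ring has no m <> 0 with mRm = 0, so the first argument
   also yields its regularity. *)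
Require Import Defs.
From mathcomp Require Import all_boot all_algebra.
From mathcomp Require Import boolp classical_sets.

Set Implicit Arguments.
Unset Strict Implicit.
Unset Printing Implicit Defensive.

Import GRing.Theory.
Local Open Scope classical_set_scope.
Local Open Scope ring_scope.

(** * Chain conditions and minimal elements *)

Lemma minimal_element (T : Type) (lt : T -> T -> Prop) :
  (forall u : nat -> T, ~ forall n, lt (u n.+1) (u n)) ->
  forall (P : T -> Prop) x0, P x0 ->
  exists2 x, P x & forall y, P y -> ~ lt y x.
Proof.
move=> nodesc P x0 Px0; apply: contrapT => nomin.
have step (x : {x | P x}) : exists y : {x | P x}, lt (sval y) (sval x).
  apply: contrapT => noy; apply: nomin; exists (sval x); first exact: svalP.
  by move=> y Py ltyx; apply: noy; exists (exist _ y Py).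
have [f fP] := choice step.
apply: (nodesc (fun n => sval (iter n f (exist _ x0 Px0)))) => n.
exact: fP.
Qed.

Lemma dcc_onS (T : Type) (P Q : set T -> Prop) :
  (forall I, P I -> Q I) -> dcc_on Q -> dcc_on P.
Proof. by move=> PQ dccQ F PF; apply: dccQ => n; apply: PQ. Qed.

(** * Principal left ideals: from DCC to regularity *)

Section PrincipalLeftIdeals.
Variable R : pzRingType.
Implicit Types (a b m r s x y z : R).

(** Both [semiprime] and [semisimple] imply this, so one regularity proof serves both. *)
Definition elt_semiprime := forall m, (forall s, m * s * m = 0) -> m = 0.

Definition principal_left I := exists a, I = lprincipal a.

(** Strict inclusion of Ra in Rb, tested on generators. *)
Definition lprincipal_lt a b := lprincipal b a /\ ~ lprincipal a b.

Lemma lprincipal_left_ideal a : left_ideal (lprincipal a).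
Proof.
split; first by exists 0; rewrite ?mul0r.
  by move=> _ _ [x _ <-] [y _ <-]; exists (x - y); rewrite ?mulrBl.
by move=> r _ [x _ <-]; exists (r * x); rewrite ?mulrA.
Qed.

Lemma lprincipal_nodesc : dcc_on principal_left ->
  forall u : nat -> R, ~ forall n, lprincipal_lt (u n.+1) (u n).
Proof.
move=> dcc u desc; have [n|n|N FN] := dcc (fun n => lprincipal (u n)).
- by exists (u n).
- have [[r _ ur] _] := desc n.
  by move=> _ [t _ <-]; exists (t * r); rewrite -?ur ?mulrA.
have [_] := desc N; rewrite FN ?leqnSn //; apply.
by exists 1; rewrite ?mul1r.
Qed.

(** Brauer's lemma: a minimal Rm inside Ra has some nonzero msm, which generates Rm, so m = tmsm.
    The idempotent is e = stm, which fixes sm. *)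
Lemma lprincipal_idempotent a : elt_semiprime -> dcc_on principal_left ->
  a <> 0 -> exists r, r * a <> 0 /\ r * a * (r * a) = r * a.
Proof.
move=> spR dcc a0.
have [|m [m0 [c _ mE]] minm] := minimal_element (lprincipal_nodesc dcc)
  (P := fun x => x <> 0 /\ lprincipal a x) (x0 := a).
  by split=> //; exists 1; rewrite ?mul1r.
have Rm y : y <> 0 -> lprincipal m y -> lprincipal y m.
  move=> y0 my; apply: contrapT => ym; case: (minm y) => //; split=> //.
  by have [d _ <-] := my; exists (d * c); rewrite -?mE ?mulrA.
have [s msm] : exists s, m * s * m <> 0.
  apply: contrapT => nos; apply: m0; apply: spR => s.
  by apply: contrapT => ms; apply: nos; exists s.
have [|t _ tE] := Rm _ msm; first by exists (m * s).
pose e := s * t * m.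
have ex : e * (s * m) = s * m.
  by rewrite /e -[RHS]/(s * m) -[in RHS]tE !mulrA.
(* Otherwise m is a left multiple of ee - e, which kills sm, so msm = 0. *)
have ee : e * e = e.
  apply: contrapT => /eqP; rewrite -subr_eq0 => /eqP e0.
  have [|w _ wE] := Rm _ e0.
    by exists (e * (s * t) - s * t); rewrite // mulrBl /e !mulrA.
  apply: msm; rewrite -mulrA -[X in X * (s * m)]wE -mulrA mulrBl -mulrA !ex.
  by rewrite subrr mulr0.
exists (s * t * c); rewrite -mulrA mE -/e; split=> // e0.
by apply: msm; rewrite -mulrA -ex e0 mul0r mulr0.
Qed.

(* For a nonzero idempotent r a, the element a - a r a generates a strictly
   smaller left ideal, and (McCoy) it is regular only if a is. *)
Lemma semiprime_dcc_regular :
  elt_semiprime -> dcc_on principal_left -> von_neumann_regular R.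
Proof.
move=> spR dcc a0; apply: contrapT => nra0.
have [a nra mina] := minimal_element (lprincipal_nodesc dcc)
  (P := fun x => ~ exists b, x = x * b * x) nra0.
have [|r [ra0 rara]] := lprincipal_idempotent spR dcc (a := a).
  by move=> a0'; apply: nra; exists 0; rewrite a0' !mul0r.
pose a' := a - a * r * a.
have a'l : (1 - a * r) * a = a' by rewrite mulrBl mul1r.
have a'r : a * (1 - r * a) = a' by rewrite mulrBr mulr1 mulrA.
have [b bE] : exists b, a' = a' * b * a'.
  apply: contrapT => nra'; apply: (mina a' nra'); split.
    by exists (1 - a * r).
  (* If a = ta', then ra = (ra)(ra) = rta(1 - ra)ra = 0. *)
  move=> [t _ tE]; apply: ra0.
  rewrite -rara -[X in r * X * _]tE -!mulrA -a'r -!mulrA.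
  by rewrite mulrBl mul1r rara subrr !mulr0.
(* Read off from a = ara + a'ba', with a' = a(1 - ra) on the left and a' = (1 - ar)a on the
   right. *)
apply: nra; exists (r + (1 - r * a) * b * (1 - a * r)).
rewrite mulrDr mulrDl !mulrA a'r -(mulrA _ (1 - _) a) a'l -bE.
by rewrite addrC subrK.
Qed.

Lemma lannK (X : set R) : lann (rann (lann X)) = lann X.
Proof.
apply/seteqP; split=> x xP y yP; last exact: yP.
by apply: xP => z; apply.
Qed.

(** Ra = l(b) gives Ra = l(r(Ra)), so a descending chain is recovered from the ascending chain of
    its right annihilators. *)
Lemma pseudo_morphic_dcc : pseudo_morphic R -> acc_right_annihilators R ->
  dcc_on principal_left.
Proof.
move=> pm acc F Fpr Fdec.
have FE n : F n = lann (rann (F n)).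
  by have [a ->] := Fpr n; have [b [_ [-> _]]] := pm a; rewrite lannK.
have [n|n x xP y /Fdec|N NP] := acc (fun n => rann (F n)).
- by exists (F n).
- exact: xP.
by exists N => n Nn; rewrite FE NP // -FE.
Qed.

(** The ideal [I] generated by m squares to zero: the x with xRm = 0 form a two-sided ideal
    containing m, and so do the y with xRy = 0, for each x in [I]. *)
Lemma semiprime_elt : semiprime R -> elt_semiprime.
Proof.
move=> spR m mRm.
pose I := [set x | forall J, two_sided_ideal J -> J m -> J x].
have I0 : I 0 by move=> J [[J0 _ _] _] _.
have IB x y : I x -> I y -> I (x - y).
  move=> Ix Iy J Jid Jm; have [[_ JB _] _] := Jid.
  by apply: JB; [apply: Ix | apply: Iy].
have Iid : two_sided_ideal I.
  split; split=> // r x Ix J Jid Jm.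
    by have [[_ _ JM] _] := Jid; apply: JM; apply: Ix.
  by have [_ [_ _ JM]] := Jid; apply: JM; apply: (Ix).
have IRm x r : I x -> x * r * m = 0.
  move=> Ix; apply: (Ix [set x | forall r, x * r * m = 0]) => //.
  split; split => /=.
  - by move=> s; rewrite !mul0r.
  - by move=> y z yP zP s; rewrite !mulrBl yP zP subrr.
  - by move=> s y yP t; rewrite -!mulrA mulrA -mulrA (mulrA y) yP mulr0.
  - by move=> s; rewrite !mul0r.
  - by move=> y z yP zP s; rewrite !mulrBl yP zP subrr.
  - by move=> y s yP t; rewrite -(mulrA y) yP.
have II x y : I x -> I y -> x * y = 0.
  move=> Ix Iy; rewrite -[x]mulr1.
  apply: (Iy [set y | forall r, x * r * y = 0]) => [|r]; last exact: IRm.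
  split; split => /=.
  - by move=> s; rewrite mulr0.
  - by move=> z w zP wP s; rewrite mulrBr zP wP subrr.
  - by move=> s z zP t; rewrite mulrA -(mulrA x) zP.
  - by move=> s; rewrite mulr0.
  - by move=> z w zP wP s; rewrite mulrBr zP wP subrr.
  - by move=> z s zP t; rewrite mulrA zP mul0r.
have Im : I m by move=> J.
suff Iset0 : I = [set 0] by move: Im; rewrite Iset0.
apply: spR => //; exists 2; apply/seteqP; split=> x; last first.
  move=> ->; exists 0, (fun=> 0), (fun=> 0).
  by split; [case | case | rewrite big_ord0].
(* [ideal_exp I 2] is I(IR): each [b i] is itself a sum of products with left factors in [I]. *)
move=> [n [a [b [Ia bP ->]]]]; apply: big1 => i _.
have [k [c [d [Ic _ ->]]]] := bP i.
by rewrite mulr_sumr big1 // => j _; rewrite mulrA (II _ _ (Ia i) (Ic j))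
  mul0r.
Qed.

(** For y in a simple summand, if ym is nonzero then ymR is the whole summand, so y = ymr and ym =
    ymrm = 0. Since 1 is a sum of such y, m = 0. *)
Lemma semisimple_elt_semiprime : semisimple R -> elt_semiprime.
Proof.
move=> [K [M [Msimple _ sumM]]] m mRm.
have Mm k y : M k y -> y * m = 0.
  move=> My; have [[M0 MB MM] _ Mmin] := Msimple k.
  pose J := [set y * m * r | r in setT].
  have Jym : J (y * m) by exists 1; rewrite ?mulr1.
  case: (Mmin J).
  - split; first by exists 0; rewrite ?mulr0.
      by move=> _ _ [s _ <-] [t _ <-]; exists (s - t); rewrite ?mulrBr.
    by move=> _ s [t _ <-]; exists (t * s); rewrite ?mulrA.
  - by move=> _ [s _ <-]; apply/MM/MM.
  - by move=> J0; move: Jym; rewrite J0.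
  move=> JM; have : J y by rewrite JM.
  by move=> [r _ yE]; rewrite -yE -2!mulrA (mulrA m) mRm mulr0.
have [s [x [_ Mx oneE]]] : family_sum M 1 by rewrite sumM.
by rewrite -[m]mul1r oneE mulr_suml big1 // => k _; apply: Mm.
Qed.

End PrincipalLeftIdeals.

(** * Idempotents in a regular ring: DCC on right ideals and semisimplicity *)

Section Idempotents.
Variable R : pzRingType.
Implicit Types (a b e f g r s x y z : R) (I : set R).

Definition idempotent_dcc := forall e : nat -> R,
  (forall n, e n * e n = e n) ->
  (forall n, e n * e n.+1 = e n.+1 /\ e n.+1 * e n = e n.+1) ->
  exists N, forall n, (N <= n)%N -> e n = e N.

Definition idempotent_lt f e := [/\ e * f = f, f * e = f & f <> e].

Lemma acc_idempotent_dcc : acc_right_annihilators R -> idempotent_dcc.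
Proof.
move=> acc e ee ele.
have [n|n y yP _ ->|N NP] := acc (fun n => rann [set e n]).
- by exists [set e n].
- by rewrite -(ele n).2 -mulrA yP ?mulr0.
exists N => n Nn.
have eNn : e N * e n = e n.
  elim: n Nn => [|n IH]; first by rewrite leqn0 => /eqP ->.
  rewrite leq_eqVlt => /predU1P[<- //|]; rewrite ltnS => /IH eNn.
  by rewrite -(ele n).1 mulrA eNn.
(* As r([e n]) = r([e N]), also [e N] kills 1 - [e n], so [e N] = [e N * e n] = [e n]. *)
have : rann [set e n] (1 - e n) by move=> _ ->; rewrite mulrBr mulr1 ee subrr.
rewrite NP // => /(_ _ erefl) /eqP.
by rewrite mulrBr mulr1 eNn subr_eq0 => /eqP.
Qed.

Hypothesis dccR : idempotent_dcc.

Lemma idempotent_nodesc (u : nat -> R) : (forall n, u n * u n = u n) ->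
  ~ forall n, idempotent_lt (u n.+1) (u n).
Proof.
move=> uu desc; have [n||N NP] := dccR (e := u); [exact: uu| |].
  by move=> n; have [] := desc n.
by have [_ _] := desc N; apply; apply: NP.
Qed.

Lemma minimal_idempotent (P : R -> Prop) e0 :
  P e0 -> e0 * e0 = e0 ->
  exists e, [/\ P e, e * e = e &
    forall f, P f -> f * f = f -> ~ idempotent_lt f e].
Proof.
move=> Pe0 ee0.
(* Idempotents are packed into a subtype because [idempotent_dcc] covers only chains of
   idempotents. *)
have [u uP|[e ee] Pe mine] := @minimal_element {e : R | e * e = e}
    (fun p q => idempotent_lt (sval p) (sval q)) _
    (fun p => P (sval p)) (exist (fun e : R => e * e = e) e0 ee0) Pe0.
  apply: (idempotent_nodesc (u := fun n => sval (u n))) uP => n.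
  exact: (proj2_sig (u n)).
exists e; split=> // f Pf ff.
exact: (mine (exist (fun e => e * e = e) f ff)).
Qed.

Hypothesis regR : von_neumann_regular R.

(* If e is a maximal idempotent of I and y = x - e x is nonzero, then
   g = y b (1 - e), where y = y b y, is a nonzero idempotent of I orthogonal to
   e, so that e + g contradicts maximality. *)
Lemma right_ideal_idempotent I : right_ideal I ->
  exists e, [/\ e * e = e, I e & forall x, I x -> e * x = x].
Proof.
move=> [I0 IB IM].
have ID x y : I x -> I y -> I (x + y).
  by move=> Ix Iy; rewrite -[y]opprK -[- y]sub0r; exact: IB (IB _ _ I0 Iy).
(* A maximal idempotent of [I] is the complement of a minimal c; the start c = 1 stands for the
   idempotent 0. *)
have [||c [Ic cc minc]] :=
  minimal_idempotent (P := fun c => I (1 - c)) (e0 := 1).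
- by rewrite subrr.
- by rewrite mulr1.
pose e := 1 - c.
have ec : e * c = 0 by rewrite mulrBl mul1r cc subrr.
have ce : c * e = 0 by rewrite mulrBr mulr1 cc subrr.
have ee : e * e = e by rewrite /e mulrBr mulr1 -/e ec subr0.
exists e; split=> // x Ix.
pose y := x - e * x.
have Iy : I y by apply/IB/IM.
have ey : e * y = 0 by rewrite mulrBr mulrA ee subrr.
have [b yby] := regR y.
pose g := y * b * c.
have eg : e * g = 0 by rewrite /g !mulrA ey !mul0r.
have cg : c * g = g by rewrite -[RHS]mul1r -[1](subrK c) -/e mulrDl eg add0r.
have gc : g * c = g by rewrite /g -!mulrA cc.
have cy : c * y = y by rewrite -[RHS]mul1r -[1](subrK c) -/e mulrDl ey add0r.
have gy : g * y = y by rewrite /g -mulrA cy -yby.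
have gg : g * g = g by rewrite {2}/g !mulrA gy -/g.
have cge : 1 - (c - g) = e + g by rewrite opprB addrCA addrC.
have g0 : g = 0.
  apply: contrapT => g0; apply: (minc (c - g)).
  - by rewrite cge; apply: ID => //; apply/IM/IM.
  - by rewrite mulrBr !mulrBl cc cg gc gg subrr subr0.
  split; rewrite ?mulrBr ?mulrBl ?cc ?cg ?gc // => /eqP.
  by rewrite -subr_eq0 addrAC subrr add0r oppr_eq0 => /eqP.
by move: gy; rewrite g0 mul0r => /esym/eqP; rewrite subr_eq0 => /eqP.
Qed.

(* Replacing the generators g n by e (n+1) = g (n+1) * e n makes the idempotent
   generators themselves descend. *)
Lemma right_artinian : dcc_on (@right_ideal R).
Proof.
move=> F Fid Fdec.
have [g gP] := choice (fun n => right_ideal_idempotent (Fid n)).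
pose e := fix e n := if n is n'.+1 then g n'.+1 * e n' else g 0.
have eP n : [/\ e n * e n = e n, F n (e n) & forall x, F n x -> e n * x = x].
  elim: n => [|n [een Fen en1]]; first exact: gP.
  have [gg Fg g1] := gP n.+1; have eg : e n * g n.+1 = g n.+1 by apply/en1/Fdec.
  split=> /=; first by rewrite -mulrA (mulrA (e n)) eg mulrA gg.
    by have [_ _] := Fid n.+1; apply.
  by move=> x Fx; rewrite -mulrA en1 ?g1 //; apply: Fdec.
have [n|n|N NP] := dccR (e := e); first by have [] := eP n.
  have [een Fen en1] := eP n; have [_ Fen' _] := eP n.+1.
  by split; [apply/en1/Fdec | rewrite /= -mulrA een].
exists N => n Nn; apply/seteqP; split=> x Fx.
  elim: n Nn x Fx {NP} => [|n IH]; first by rewrite leqn0 => /eqP ->.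
  by rewrite leq_eqVlt => /predU1P[<- //|]; rewrite ltnS => /IH FnN x /Fdec/FnN.
have [_ _ /(_ _ Fx) <-] := eP N; have [_ Fen _] := eP n.
by rewrite -(NP _ Nn); have [_ _] := Fid n; apply.
Qed.

Lemma rprincipal_right_ideal a : right_ideal (rprincipal a).
Proof.
split; first by exists 0; rewrite ?mulr0.
  by move=> _ _ [x _ <-] [y _ <-]; exists (x - y); rewrite ?mulrBr.
by move=> _ r [x _ <-]; exists (x * r); rewrite ?mulrA.
Qed.

(** A nonzero x = xbx in J gives the idempotent f = xbe in J, below e and nonzero as fx = x; so f =
    e and J = eR. *)
Lemma primitive_simple e : e * e = e -> e <> 0 ->
  (forall f, f <> 0 -> f * f = f -> ~ idempotent_lt f e) ->
  simple_right_ideal (rprincipal e).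
Proof.
move=> ee e0 mine; split; first exact: rprincipal_right_ideal.
  move=> eR0; apply: e0; have : rprincipal e e by exists 1; rewrite ?mulr1.
  by rewrite eR0.
move=> J [J0 JB JM] JeR; case: (pselect (J `<=` [set 0])) => [J0'|].
  by left; apply/seteqP; split=> // _ ->.
move=> /existsNP[x /not_implyP[Jx x0]]; right.
apply/seteqP; split=> // _ [r _ <-]; apply: (JM).
have [b xbx] := regR x; have [s _ esx] := JeR _ Jx.
have ex : e * x = x by rewrite -esx mulrA ee.
pose f := x * b * e.
have fx : f * x = x by rewrite /f -mulrA ex -xbx.
have <- : f = e; last by apply/JM/JM.
apply: contrapT => fe; apply: (mine f).
- by move=> f0; apply: x0; rewrite -fx f0 mul0r.
- by rewrite {2}/f !mulrA fx.
by split=> //; rewrite /f ?mulrA ?ex // -mulrA ee.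
Qed.

Definition orthogonally_decomposable e := exists n (E : 'I_n -> R),
  [/\ forall i, simple_right_ideal (rprincipal (E i)),
      forall i j, E i * E j = if i == j then E i else 0 &
      e = \sum_i E i].

(** In a minimal counterexample e, split off a minimal nonzero idempotent f below e: fR is simple,
    and e - f is decomposable by minimality. *)
Lemma idempotent_decomposable e : e * e = e -> orthogonally_decomposable e.
Proof.
move=> ee0; apply: contrapT => nde0.
have [{ee0 nde0}e [nde ee mine]] :=
  minimal_idempotent (P := fun e => ~ orthogonally_decomposable e) nde0 ee0.
have e0 : e <> 0.
  move=> e0; apply: nde; exists 0, (fun=> 0).
  by split; [case | case | rewrite big_ord0].
have [|f [[f0 ef fe] ff minf]] := minimal_idempotent
  (P := fun f => [/\ f <> 0, e * f = f & f * e = f]) _ ee; first by split.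
have simplef : simple_right_ideal (rprincipal f).
  apply: primitive_simple => // h h0 hh hf; apply: (minf h) => //.
  case: hf => fh hf _; split=> //; first by rewrite -fh mulrA ef.
  by rewrite -hf -mulrA fe.
have efef : (e - f) * (e - f) = e - f.
  by rewrite mulrBr !mulrBl ee ef fe ff subrr subr0.
have [n [E [simpleE orthE sumE]]] : orthogonally_decomposable (e - f).
  apply: contrapT => /mine; apply=> //.
  split; rewrite ?mulrBr ?mulrBl ?ee ?ef ?fe // => /eqP.
  by rewrite -subr_eq0 addrAC subrr add0r oppr_eq0 => /eqP.
have fE i : f * E i = 0.
  have <- : (e - f) * E i = E i.
    rewrite sumE mulr_suml (bigD1 i) //= orthE eqxx big1 ?addr0 // => j ji.
    by rewrite orthE (negPf ji).
  by rewrite mulrA mulrBr fe ff subrr mul0r.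
have Ef i : E i * f = 0.
  have <- : E i * (e - f) = E i.
    rewrite sumE mulr_sumr (bigD1 i) //= orthE eqxx big1 ?addr0 // => j ji.
    by rewrite orthE eq_sym (negPf ji).
  by rewrite -mulrA mulrBl ef ff subrr mulr0.
(* Index 0 carries f; the other indices carry [E], shifted by one. *)
apply: nde; exists n.+1, (fun i => oapp E f (unlift ord0 i)); split.
- by move=> i; case: unliftP => [j|] _ /=.
- move=> i j; case: unliftP => [i'|] ->; case: unliftP => [j'|] -> /=;
    rewrite ?eqxx ?(inj_eq lift_inj) //.
- rewrite big_ord_recl unlift_none /=.
  under eq_bigr do rewrite liftK.
  by rewrite -sumE addrC subrK.
Qed.

Lemma regular_semisimple : semisimple R.
Proof.
have [n [E [simpleE orthE oneE]]] := idempotent_decomposable (mulr1 1).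
exists 'I_n, (fun i => rprincipal (E i)); split=> //.
  move=> s x us xP sum0 k ks.
  (* Left multiplication by [E k] projects onto the k-th summand. *)
  have ExE j : E k * x j = if k == j then x j else 0.
    have [y _ <-] := xP j; rewrite mulrA orthE.
    by case: eqP => [->|_]; rewrite ?mul0r.
  have := mulr0 (E k); rewrite -{1}sum0 mulr_sumr (bigD1_seq k) //= ExE eqxx.
  by rewrite big1 ?addr0 // => j jk; rewrite ExE eq_sym (negPf jk).
apply/seteqP; split=> // z _; exists (index_enum 'I_n), (fun i => E i * z).
split; first exact: index_enum_uniq.
  by move=> i; exists z.
by rewrite -mulr_suml -oneE mul1r.
Qed.

End Idempotents.

(** * Regular rings: morphic conditions, semiprimeness, two-sided artinianity *)

Section Regular.
Variable R : pzRingType.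
Hypothesis regR : von_neumann_regular R.

(** With a = aba, the idempotents ba and ab satisfy Ra = Rba and aR = abR; the witnesses are their
    complements. *)
Lemma regular_quasi_morphic : quasi_morphic R.
Proof.
move=> a; have [b aba] := regR a.
exists (1 - b * a), (1 - a * b), (1 - a * b), (1 - b * a); split.
- apply/seteqP; split=> [_ [r _ <-] _ -> | x /(_ _ erefl)].
    by rewrite mulrBr mulr1 !mulrA -(mulrA r) -(mulrA r) -aba subrr.
  rewrite mulrBr mulr1 mulrA => /eqP; rewrite subr_eq0 => /eqP xE.
  by exists (x * b); rewrite -?xE.
- apply/seteqP; split=> [x /(_ _ erefl) xa | _ [r _ <-] _ ->].
    by exists x; rewrite // mulrBr mulr1 mulrA xa mul0r subr0.
  by rewrite -mulrA mulrBl mul1r -aba subrr mulr0.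
- apply/seteqP; split=> [_ [r _ <-] _ -> | x /(_ _ erefl)].
    by rewrite mulrA mulrBl mul1r -aba subrr mul0r.
  rewrite mulrBl mul1r => /eqP; rewrite subr_eq0 => /eqP xE.
  by exists (b * x); rewrite // mulrA -xE.
- apply/seteqP; split=> [x /(_ _ erefl) ax | _ [r _ <-] _ ->].
    by exists x; rewrite // mulrBl mul1r -mulrA ax mulr0 subr0.
  by rewrite mulrA mulrBr mulr1 mulrA -aba subrr mul0r.
Qed.

(** Writing x = (xb)x shows by induction that I is contained in every power of I. *)
Lemma regular_semiprime : semiprime R.
Proof.
move=> I [[I0 IB IMl] [_ _ IMr]] [n In]; apply/seteqP.
split=> [x Ix|_ ->] //; rewrite -In.
elim: n {In} x Ix => [//|n IH] x Ix; have [b xbx] := regR x.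
exists 1, (fun=> x * b), (fun=> x); split; last by rewrite big_ord1 -xbx.
  by move=> _; apply: IMr.
by move=> _; apply: IH.
Qed.

Hypothesis dccR : idempotent_dcc R.

Lemma regular_artinian : artinian R.
Proof.
split; last exact: right_artinian.
(* Left ideals are right ideals of the opposite ring, to which both hypotheses transfer. *)
have regRc : von_neumann_regular R^c.
  by move=> a; have [b aba] := regR a; exists b; rewrite {1}aba -mulrA.
have dccRc : idempotent_dcc R^c.
  by move=> e ee ele; apply: dccR => // n; have [] := ele n.
apply: dcc_onS (right_artinian dccRc regRc) => I [I0 IB IM].
by split=> // x r Ix; apply: (IM r x).
Qed.

End Regular.

Theorem theorem18 (R : pzRingType) (hR : right_goldie R) :
  [/\ (semiprime R /\ pseudo_morphic R) <-> (semiprime R /\ quasi_morphic R),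
      (semiprime R /\ pseudo_morphic R) <-> von_neumann_regular R &
      von_neumann_regular R <-> semisimple_artinian R].
Proof.
have [_ acc] := hR.
have quasi_pseudo : quasi_morphic R -> pseudo_morphic R.
  by move=> qm a; have [b [c [b' [c' [Ra _ aR _]]]]] := qm a; exists b, b'.
have pseudo_regular : semiprime R /\ pseudo_morphic R -> von_neumann_regular R.
  move=> [/semiprime_elt spR pmR].
  exact/(semiprime_dcc_regular spR)/pseudo_morphic_dcc.
split; split.
- move=> [spR pmR]; split=> //.
  exact/regular_quasi_morphic/pseudo_regular.
- by move=> [spR /quasi_pseudo].
- exact: pseudo_regular.
- move=> regR; split; first exact: regular_semiprime.
  exact/quasi_pseudo/regular_quasi_morphic.
- move=> regR; have dccR := acc_idempotent_dcc acc.
  by split; [apply: regular_semisimple | apply: regular_artinian].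
- move=> [/semisimple_elt_semiprime spR [dccl _]].
  apply: semiprime_dcc_regular spR _; apply: dcc_onS dccl => _ [a ->].
  exact: lprincipal_left_ideal.
Qed.
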